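(* Let $f\in L_{2\pi}$ be complex valued with Fourier coefficients $\hat f(k)=\frac1{2\pi}\int_{-\pi}^{\pi}f(x)e^{-ikx}dx$, and let $\{\psi_n\}_{n\ge1}$ be a decreasing sequence of positive numbers tending to zero with $\psi_n=O(\psi_{2n})$. Suppose $\{\hat f(n)\}_{n\ge0}\in NBVS$ and $\{\hat f(-n)\}_{n\ge0}\in NBVS$, and let $S_n(f,x)=\sum_{k=-n}^n\hat f(k)e^{ikx}$. Then $$\|f-S_n(f)\|_L=O(\psi_n)\quad(n\to\infty)$$ if and only if both $E_n(f)_L=O(\psi_n)$ as $n\to\infty$ and $\hat f(n)\log|n|=O(\psi_{|n|})$ as $|n|\to\infty$.
   Context: For $\theta_0\in[0,\pi/2)$ let $M(\theta_0)=\{z\in\mathbb C: |\arg z|\le\theta_0\}$ (with $0\in M(\theta_0)$). Write $\Delta c_n=c_n-c_{n+1}$. A complex sequence $\mathbf C=\{c_n\}$ belongs to $NBVS$ if there is $\theta_0\in[0,\pi/2)$ with $c_n\in M(\theta_0)$ for all $n\ge1$ and a constant $K(\mathbf C)>0$ such that $\sum_{n=m}^{2m}|\Delta c_n|\le K(\mathbf C)\big(|c_m|+|c_{2m}|\big)$ for all $m\ge1$. $L_{2\pi}$ is the space of complex valued $2\pi$-periodic integrable functions with norm $\|g\|_L=\int_{-\pi}^{\pi}|g(x)|dx$, and $E_n(f)_L=\inf_{a_k\in\mathbb C}\|f-\sum_{k=-n}^na_ke^{ikx}\|_L$. *)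

(* Defs.v *)
From HB Require Import structures.
From mathcomp Require Import all_boot all_order all_algebra.
From mathcomp Require Import all_classical all_reals all_analysis.
From mathcomp Require Import complex.
Set Implicit Arguments. Unset Strict Implicit. Unset Printing Implicit Defensive.
Import Order.TTheory GRing.Theory Num.Theory.
Import numFieldNormedType.Exports.
Local Open Scope classical_set_scope.
Local Open Scope ring_scope.

Section Defs.
Variable R : realType.

Definition cmod (z : R[i]) : R := Num.sqrt (complex.Re z ^+ 2 + complex.Im z ^+ 2).

Definition expi (t : R) : R[i] := Complex (cos t) (sin t).

Definition cint (g : R -> R[i]) : R[i] :=
  Complex (Rintegral lebesgue_measure `[- pi, pi] (fun x => complex.Re (g x)))
          (Rintegral lebesgue_measure `[- pi, pi] (fun x => complex.Im (g x))).

Definition L2pi (f : R -> R[i]) : Prop :=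
  (forall x, f (x + 2 * pi) = f x) /\
  lebesgue_measure.-integrable `[- pi, pi] (fun x => (complex.Re (f x))%:E) /\
  lebesgue_measure.-integrable `[- pi, pi] (fun x => (complex.Im (f x))%:E).

Definition normL (g : R -> R[i]) : R :=
  Rintegral lebesgue_measure `[- pi, pi] (fun x => cmod (g x)).

Definition fcoef (f : R -> R[i]) (k : int) : R[i] :=
  (((2 * pi)^-1)%:C)%C * cint (fun x => f x * expi (- (k%:~R * x))).

Definition trigpol (n : nat) (a : int -> R[i]) (x : R) : R[i] :=
  \sum_(0 <= j < (2 * n).+1)
     a (j%:Z - n%:Z) * expi ((j%:Z - n%:Z)%:~R * x).

Definition Sn (f : R -> R[i]) (n : nat) (x : R) : R[i] := trigpol n (fcoef f) x.

Definition En (f : R -> R[i]) (n : nat) : R :=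
  inf [set normL (fun x => f x - trigpol n a x) | a in [set: int -> R[i]]].

(* z \in M(theta0) = {z : |arg z| <= theta0}, 0 included; for theta0 < pi/2,
   a nonzero z with |arg z| <= theta0 has Re z > 0 and arg z = atan (Im z / Re z) *)
Definition inM (theta0 : R) (z : R[i]) : Prop :=
  z = 0 \/ (0 < complex.Re z /\ `| atan (complex.Im z / complex.Re z) | <= theta0).

(* the class NBVS (sequence c indexed by n >= 1; c 0 is irrelevant) *)
Definition NBVS (c : nat -> R[i]) : Prop :=
  (exists2 theta0 : R, 0 <= theta0 < pi / 2 &
     forall n, (1 <= n)%N -> inM theta0 (c n)) /\
  exists2 K : R, 0 < K &
    forall m, (1 <= m)%N ->
      \sum_(m <= n < (2 * m).+1) cmod (c n - c n.+1)
        <= K * (cmod (c m) + cmod (c (2 * m)%N)).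

(* u_n = O(v_n) as n -> oo (for nonnegative v) *)
Definition bigO_nat (u v : nat -> R) : Prop :=
  exists C : R, exists N : nat, forall n, (N <= n)%N -> `|u n| <= C * v n.

End Defs.

(* Main.v *)
Require Import Defs.
From HB Require Import structures.
From mathcomp Require Import all_boot all_order all_algebra.
From mathcomp Require Import all_classical all_reals all_analysis.
From mathcomp Require Import complex measurable_realfun.
From mathcomp Require Import ring lra zify.
Set Implicit Arguments. Unset Strict Implicit. Unset Printing Implicit Defensive.
Import Order.TTheory GRing.Theory Num.Theory.
Import numFieldNormedType.Exports.
Local Open Scope classical_set_scope.
Local Open Scope ring_scope.

(* Write c k for the Fourier coefficients of f.
   Necessity: E_n(f) <= |f - S_n(f)| is trivial. Testing f - S_n(f) against the bounded
   function e^{-inx} sum_{k <= n} sin(kx)/k bounds |sum_{k <= n} c_{n+k}/k| by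
   |f - S_n(f)|; the sector condition moves the modulus inside the sum, and since the NBVS
   condition gives |c_N| = O(|c_m| + |c_{2m}|) for m <= N <= 2m, taking n = N/2 and
   m = n + k yields c_N log N = O(psi_N).
   Sufficiency: the de la Vallee Poussin mean (1/n) sum_{n <= m < 2n} S_m is bounded on L^1
   and reproduces trigonometric polynomials of degree n, so it is within O(E_n(f)) of f.
   It remains to bound S_m(f) - S_n(f) for n <= m < 2n; Abel summation bounds its norm by
   the variation of c over [n, 2n] times an L^1 norm of a geometric sum, which is O(log n). *)

(** * Modulus, real and imaginary parts, and unimodular exponentials *)

Section ComplexModulus.
Context {R : realType}.
Implicit Types (z w : R[i]).

Lemma cmodE z : cmod z = Normc.normc z. Proof. by case: z. Qed.

Lemma cmod_ge0 z : 0 <= cmod z. Proof. exact: sqrtr_ge0. Qed.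

Lemma cmod0 : cmod (0 : R[i]) = 0. Proof. by rewrite cmodE Normc.normc0. Qed.

Lemma cmodM z w : cmod (z * w) = cmod z * cmod w.
Proof. by rewrite !cmodE Normc.normcM. Qed.

Lemma cmodN z : cmod (- z) = cmod z.
Proof. by case: z => a b; rewrite /cmod /= !sqrrN. Qed.

Lemma cmodD z w : cmod (z + w) <= cmod z + cmod w.
Proof. by rewrite !cmodE; exact: (@le_normcD R). Qed.

Lemma cmodB z w : cmod (z - w) <= cmod z + cmod w.
Proof. by rewrite -(cmodN w) cmodD. Qed.

Lemma cmod_sum (I : Type) (r : seq I) (P : pred I) (F : I -> R[i]) :
  cmod (\sum_(i <- r | P i) F i) <= \sum_(i <- r | P i) cmod (F i).
Proof.
elim/big_ind2 : _ => [|x a y b xa yb|//]; first by rewrite cmod0.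
by rewrite (le_trans (cmodD _ _)) // lerD.
Qed.

Lemma Re_le_cmod z : `|complex.Re z| <= cmod z.
Proof.
by rewrite -sqrtr_sqr /cmod ler_sqrt ?addr_ge0 ?sqr_ge0 // lerDl sqr_ge0.
Qed.

Lemma Im_le_cmod z : `|complex.Im z| <= cmod z.
Proof.
by rewrite -sqrtr_sqr /cmod ler_sqrt ?addr_ge0 ?sqr_ge0 // lerDr sqr_ge0.
Qed.

Lemma cmod_le z : cmod z <= `|complex.Re z| + `|complex.Im z|.
Proof.
rewrite -[leRHS]ger0_norm ?addr_ge0 // -sqrtr_sqr /cmod ler_sqrt ?sqr_ge0 //.
by rewrite sqrrD !real_normK ?num_real // -addrA lerD2l lerDr mulrn_wge0 ?mulr_ge0.
Qed.

Lemma cmod_real (x : R) : cmod (x%:C)%C = `|x|.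
Proof. by rewrite /cmod /= expr0n addr0 sqrtr_sqr. Qed.

Lemma cmod_expi (t : R) : cmod (expi t) = 1.
Proof. by rewrite /cmod /= cos2Dsin2 sqrtr1. Qed.

Lemma expiD (s t : R) : expi (s + t) = expi s * expi t.
Proof.
by rewrite /expi cosD sinD; congr Complex; rewrite addrC [cos s * sin t]mulrC mulrC.
Qed.

Lemma ReD z w : complex.Re (z + w) = complex.Re z + complex.Re w.
Proof. by case: z; case: w. Qed.

Lemma ImD z w : complex.Im (z + w) = complex.Im z + complex.Im w.
Proof. by case: z; case: w. Qed.

Lemma ReM z w :
  complex.Re (z * w) = complex.Re z * complex.Re w - complex.Im z * complex.Im w.
Proof. by case: z; case: w. Qed.

Lemma ImM z w :
  complex.Im (z * w) = complex.Re z * complex.Im w + complex.Im z * complex.Re w.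
Proof. by case: z; case: w. Qed.

Lemma Re_sum (I : Type) (r : seq I) (P : pred I) (F : I -> R[i]) :
  complex.Re (\sum_(i <- r | P i) F i) = \sum_(i <- r | P i) complex.Re (F i).
Proof. by elim/big_rec2 : _ => // i x y _ <-; rewrite ReD. Qed.

Lemma Im_sum (I : Type) (r : seq I) (P : pred I) (F : I -> R[i]) :
  complex.Im (\sum_(i <- r | P i) F i) = \sum_(i <- r | P i) complex.Im (F i).
Proof. by elim/big_rec2 : _ => // i x y _ <-; rewrite ImD. Qed.

End ComplexModulus.

(** * Real integrals over one period, in particular of cosines and sines *)

Section Period.
Context {R : realType}.
Local Notation mu := (@lebesgue_measure R).
Implicit Types (u v h : R -> R).

Definition Int u : R := Rintegral mu `[- pi, pi] u.
Definition intble u : Prop := mu.-integrable `[- pi, pi] (EFin \o u).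

Local Lemma mI : measurable (`[- pi, pi] : set (measurableTypeR R)).
Proof. by []. Qed.

Lemma intble_cont u : continuous u -> intble u.
Proof.
move=> cu; apply: continuous_compact_integrable; first exact: segment_compact.
exact: continuous_subspaceT.
Qed.

Lemma intbleD u v : intble u -> intble v -> intble (fun x => u x + v x).
Proof. by move=> iu iv; have := integrableD mI iu iv. Qed.

Lemma intbleZ c u : intble u -> intble (fun x => c * u x).
Proof. by move=> iu; have := integrableZl mI c iu. Qed.

Lemma intbleB u v : intble u -> intble v -> intble (fun x => u x - v x).
Proof. by move=> iu iv; have := integrableB mI iu iv. Qed.

Lemma intble0 : intble (fun=> 0).
Proof. by apply: intble_cont => x; exact: cvg_cst. Qed.

Lemma intble_sum (I : Type) (r : seq I) (F : I -> R -> R) :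
  (forall i, intble (F i)) -> intble (fun x => \sum_(i <- r) F i x).
Proof.
move=> iF; elim: r => [|i r IH].
  by under eq_fun do rewrite big_nil; exact: intble0.
by under eq_fun do rewrite big_cons; exact: intbleD.
Qed.

Lemma intble_norm u : intble u -> intble (fun x => `|u x|).
Proof. by move=> iu; have := integrable_norm iu. Qed.

Lemma intble_bddM u h (M : R) : intble u -> continuous h -> (forall x, `|h x| <= M) ->
  intble (fun x => u x * h x).
Proof.
move=> iu ch hM.
have := @integrableMl _ _ _ mu _ mI (EFin \o u) h iu.
apply; first by apply: measurable_funTS; exact: continuous_measurable_fun.
exists M; split; first exact: num_real.
by move=> y My x _; apply: (le_trans (hM x)); exact: ltW.
Qed.

Lemma intble_measurable u : intble u -> measurable_fun `[- pi, pi] u.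
Proof. by move=> /measurable_int /measurable_EFinP. Qed.

Lemma intble_le u v : measurable_fun `[- pi, pi] u -> (forall x, `|u x| <= v x) ->
  intble v -> intble u.
Proof.
move=> mu' uv iv; apply: (le_integrable mI _ _ iv); first exact/measurable_EFinP.
by move=> x _; rewrite /= lee_fin (le_trans (uv x)) // ler_norm.
Qed.

Lemma eq_Int u v : u =1 v -> Int u = Int v.
Proof. by move=> uv; congr Int; exact/funext. Qed.

Lemma IntD u v : intble u -> intble v -> Int (fun x => u x + v x) = Int u + Int v.
Proof. by move=> iu iv; exact: RintegralD. Qed.

Lemma IntB u v : intble u -> intble v -> Int (fun x => u x - v x) = Int u - Int v.
Proof. by move=> iu iv; exact: RintegralB. Qed.

Lemma IntZ c u : intble u -> Int (fun x => c * u x) = c * Int u.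
Proof. by move=> iu; exact: RintegralZl. Qed.

Lemma Int_sum (I : Type) (r : seq I) (F : I -> R -> R) :
  (forall i, intble (F i)) -> Int (fun x => \sum_(i <- r) F i x) = \sum_(i <- r) Int (F i).
Proof.
move=> iF; elim: r => [|i r IH].
  rewrite (@eq_Int _ (fun x => 0 * 0)) => [|x]; last by rewrite big_nil mul0r.
  by rewrite IntZ ?mul0r ?big_nil //; exact: intble0.
rewrite (@eq_Int _ (fun x => F i x + \sum_(j <- r) F j x)) => [|x].
  by rewrite IntD ?IH ?big_cons //; exact: intble_sum.
by rewrite big_cons.
Qed.

Lemma le_Int u v : intble u -> intble v -> (forall x, - pi <= x <= pi -> u x <= v x) ->
  Int u <= Int v.
Proof.
move=> iu iv uv; apply: le_Rintegral => // x; rewrite /= in_itv /=; exact: uv.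
Qed.

Lemma Int_ge0 u : (forall x, 0 <= u x) -> 0 <= Int u.
Proof. by move=> u0; apply: Rintegral_ge0 => x _. Qed.

Lemma norm_Int u : intble u -> `|Int u| <= Int (fun x => `|u x|).
Proof. by move=> iu; exact: le_normr_Rintegral. Qed.

Lemma Int_cst (c : R) : Int (fun=> c) = c * (2 * pi).
Proof.
rewrite /Int Rintegral_cst //= lebesgue_measure_itv /= lte_fin.
by rewrite ifT; [congr (_ * _) => /=; ring | have := @pi_gt0 R; lra].
Qed.

Lemma Int_FTC2 u v : continuous u -> (forall x : R, is_derive x 1 v (u x)) ->
  Int u = v pi - v (- pi).
Proof.
move=> cu dv; rewrite /Int /Rintegral (@continuous_FTC2 _ _ v) //.
- by have := @pi_gt0 R; lra.
- exact: continuous_subspaceT.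
- have cv : continuous v.
    by move=> x; apply: differentiable_continuous; apply/derivable1_diffP; have [] := dv x.
  split; first by move=> x _; have [] := dv x.
  + by apply: cvg_at_right_filter; exact: cv.
  + by apply: cvg_at_left_filter; exact: cv.
- by move=> x _; rewrite derive1E; have [] := dv x.
Qed.

Lemma continuous_cosM (a : R) : continuous (fun x => cos (a * x)).
Proof.
by move=> x; apply: continuous_comp; [exact: mulrl_continuous|exact: continuous_cos].
Qed.

Lemma continuous_sinM (a : R) : continuous (fun x => sin (a * x)).
Proof.
by move=> x; apply: continuous_comp; [exact: mulrl_continuous|exact: continuous_sin].
Qed.

Lemma sin_nat_pi n : sin (n%:R * pi) = 0 :> R.
Proof.
elim: n => [|n IH]; first by rewrite mul0r sin0.
by rewrite -natr1 mulrDl mul1r sinDpi IH oppr0.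
Qed.

Lemma sin_int_pi (k : int) : sin (k%:~R * pi) = 0 :> R.
Proof.
case: k => n; first exact: sin_nat_pi.
by rewrite NegzE intrN mulNr sinN sin_nat_pi oppr0.
Qed.

Lemma Int_cos (k : int) : Int (fun x => cos (k%:~R * x)) = (k == 0)%:R * (2 * pi).
Proof.
have [->|k0] := eqVneq k 0.
  rewrite -Int_cst; apply: eq_Int => x; by rewrite mul0r cos0.
have kn0 : k%:~R != 0 :> R by rewrite intr_eq0.
have dv (x : R) : is_derive x 1 (fun x => k%:~R^-1 * sin (k%:~R * x)) (cos (k%:~R * x)).
  apply: is_derive_eq.
  by rewrite /GRing.scale /= mulr1 [cos _ * _]mulrC mulKf.
rewrite mul0r (Int_FTC2 _ dv) ?mulrN ?sinN ?sin_int_pi ?oppr0 ?subrr //.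
exact: continuous_cosM.
Qed.

Lemma Int_sin (k : int) : Int (fun x => sin (k%:~R * x)) = 0.
Proof.
have [->|k0] := eqVneq k 0.
  by rewrite -[RHS](mul0r (2 * pi)) -Int_cst; apply: eq_Int => x; rewrite mul0r sin0.
have kn0 : k%:~R != 0 :> R by rewrite intr_eq0.
have dv (x : R) : is_derive x 1 (fun x => - k%:~R^-1 * cos (k%:~R * x)) (sin (k%:~R * x)).
  apply: is_derive_eq.
  rewrite /GRing.scale /= mulr1 mulNr mulNr mulrN opprK.
  by rewrite [sin _ * _]mulrC mulKf.
rewrite (Int_FTC2 _ dv) ?mulrN ?cosN ?subrr //.
exact: continuous_sinM.
Qed.

End Period.

(** * Integrals and L^1 norms of complex functions over one period *)

Section ComplexIntegral.
Context {R : realType}.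
Implicit Types (g h : R -> R[i]).

Definition cintble g : Prop :=
  intble (fun x => complex.Re (g x)) /\ intble (fun x => complex.Im (g x)).

Lemma cintbleD g h : cintble g -> cintble h -> cintble (fun x => g x + h x).
Proof.
move=> [g1 g2] [h1 h2]; split.
  by under eq_fun do rewrite ReD; exact: intbleD.
by under eq_fun do rewrite ImD; exact: intbleD.
Qed.

Lemma cintbleZ c g : cintble g -> cintble (fun x => c * g x).
Proof.
move=> [g1 g2]; split.
  by under eq_fun do rewrite ReM; apply: intbleB; exact: intbleZ.
by under eq_fun do rewrite ImM; apply: intbleD; exact: intbleZ.
Qed.

Lemma cintbleB g h : cintble g -> cintble h -> cintble (fun x => g x - h x).
Proof.
move=> ig ih; under eq_fun do rewrite -[- h _]mulN1r.
by apply: cintbleD => //; exact: cintbleZ.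
Qed.

Lemma cintble_sum (I : Type) (r : seq I) (F : I -> R -> R[i]) :
  (forall i, cintble (F i)) -> cintble (fun x => \sum_(i <- r) F i x).
Proof.
move=> iF; split.
  by under eq_fun do rewrite Re_sum; apply: intble_sum => i; have [] := iF i.
by under eq_fun do rewrite Im_sum; apply: intble_sum => i; have [] := iF i.
Qed.

Lemma cintble_expi a : cintble (fun x => expi (a * x)).
Proof.
by split; apply: intble_cont; [exact: continuous_cosM|exact: continuous_sinM].
Qed.

Lemma cintble_Mexpi g a : cintble g -> cintble (fun x => g x * expi (a * x)).
Proof.
move=> [g1 g2]; have c1 := @continuous_cosM R a; have s1 := @continuous_sinM R a.
have cM u : intble u -> intble (fun x => u x * cos (a * x)).
  by move=> iu; apply: (intble_bddM iu c1) => x; exact: cos_max.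
have sM u : intble u -> intble (fun x => u x * sin (a * x)).
  by move=> iu; apply: (intble_bddM iu s1) => x; exact: sin_max.
split.
  by under eq_fun do rewrite ReM; apply: intbleB; [exact: cM|exact: sM].
by under eq_fun do rewrite ImM; apply: intbleD; [exact: sM|exact: cM].
Qed.

Lemma cintble_trigpol n a : cintble (@trigpol R n a).
Proof. by apply: cintble_sum => j; apply: cintbleZ; exact: cintble_expi. Qed.

Lemma intble_cmod g : cintble g -> intble (fun x => cmod (g x)).
Proof.
move=> [g1 g2].
apply: (@intble_le _ _ (fun x => `|complex.Re (g x)| + `|complex.Im (g x)|)).
- rewrite /cmod; apply: measurableT_comp; last first.
    apply: measurable_funD; apply: measurable_funX; exact: intble_measurable.
  by apply: continuous_measurable_fun; exact: sqrt_continuous.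
- by move=> x; rewrite ger0_norm ?cmod_ge0 // cmod_le.
- by apply: intbleD; exact: intble_norm.
Qed.

Lemma normL_ge0 g : 0 <= normL g.
Proof. by apply: Int_ge0 => x; exact: cmod_ge0. Qed.

Lemma eq_normL g h : g =1 h -> normL g = normL h.
Proof. by move=> gh; congr normL; exact/funext. Qed.

Lemma normL_le (C : R) g (u : R -> R) : cintble g -> intble u ->
  (forall x, - pi <= x <= pi -> cmod (g x) <= C * u x) -> normL g <= C * Int u.
Proof.
move=> ig iu gu; rewrite -IntZ //; apply: le_Int => //; first exact: intble_cmod.
exact: intbleZ.
Qed.

Lemma normLD g h : cintble g -> cintble h ->
  normL (fun x => g x + h x) <= normL g + normL h.
Proof.
move=> ig ih; have ig' := intble_cmod ig; have ih' := intble_cmod ih.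
rewrite /normL -[leRHS]IntD //; apply: le_Int => [||x _]; last exact: cmodD.
  by apply: intble_cmod; exact: cintbleD.
exact: intbleD.
Qed.

Lemma normLB g h : cintble g -> cintble h ->
  normL (fun x => g x - h x) <= normL g + normL h.
Proof.
move=> ig ih; have ig' := intble_cmod ig; have ih' := intble_cmod ih.
rewrite /normL -[leRHS]IntD //; apply: le_Int => [||x _]; last exact: cmodB.
  by apply: intble_cmod; exact: cintbleB.
exact: intbleD.
Qed.

Lemma normLZ c g : cintble g -> normL (fun x => c * g x) = cmod c * normL g.
Proof.
move=> ig; rewrite /normL -[RHS]IntZ; last exact: intble_cmod.
by apply: eq_Int => x; exact: cmodM.
Qed.

Lemma normL_sum (I : Type) (r : seq I) (F : I -> R -> R[i]) :
  (forall i, cintble (F i)) ->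
  normL (fun x => \sum_(i <- r) F i x) <= \sum_(i <- r) normL (F i).
Proof.
move=> iF; rewrite /normL -[leRHS]Int_sum; last by move=> i; exact: intble_cmod.
apply: le_Int => [||x _]; last exact: cmod_sum.
  by apply: intble_cmod; exact: cintble_sum.
by apply: intble_sum => i; exact: intble_cmod.
Qed.

Lemma eq_cint g h : g =1 h -> cint g = cint h.
Proof. by move=> gh; congr cint; exact/funext. Qed.

Lemma cintD g h : cintble g -> cintble h ->
  cint (fun x => g x + h x) = cint g + cint h.
Proof.
move=> [g1 g2] [h1 h2]; apply/eqP; rewrite eq_complex; apply/andP; split; apply/eqP.
  by rewrite ReD /= -[RHS]IntD //; apply: eq_Int => x; rewrite ReD.
by rewrite ImD /= -[RHS]IntD //; apply: eq_Int => x; rewrite ImD.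
Qed.

Lemma cintZ c g : cintble g -> cint (fun x => c * g x) = c * cint g.
Proof.
move=> [g1 g2]; apply/eqP; rewrite eq_complex; apply/andP; split; apply/eqP.
  rewrite ReM /= -![_ * Rintegral _ _ _]IntZ // -[RHS]IntB; try exact: intbleZ.
  by apply: eq_Int => x; rewrite ReM.
rewrite ImM /= -![_ * Rintegral _ _ _]IntZ // -[RHS]IntD; try exact: intbleZ.
by apply: eq_Int => x; rewrite ImM.
Qed.

Lemma cint_sum (I : Type) (r : seq I) (F : I -> R -> R[i]) :
  (forall i, cintble (F i)) ->
  cint (fun x => \sum_(i <- r) F i x) = \sum_(i <- r) cint (F i).
Proof.
move=> iF; elim: r => [|i r IH].
  rewrite (@eq_cint _ (fun x => 0 * expi (0 * x))) => [|x].
    by rewrite cintZ ?mul0r ?big_nil //; exact: cintble_expi.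
  by rewrite big_nil mul0r.
rewrite (@eq_cint _ (fun x => F i x + \sum_(j <- r) F j x)) => [|x].
  by rewrite cintD ?IH ?big_cons //; exact: cintble_sum.
by rewrite big_cons.
Qed.

(** The real and the imaginary part are each bounded by the norm, hence the factor 2. *)
Lemma cmod_cint g : cintble g -> cmod (cint g) <= 2 * normL g.
Proof.
move=> ig; have [g1 g2] := ig; apply: (le_trans (cmod_le _)).
rewrite mulr_natl mulr2n; apply: lerD; apply: le_trans (norm_Int _) _ => //;
  apply: le_Int => [||x _]; try exact: intble_norm; try exact: intble_cmod.
  exact: Re_le_cmod.
exact: Im_le_cmod.
Qed.

End ComplexIntegral.

(** * Symmetric sums, Fourier coefficients and partial sums *)

Section FourierCoefficients.
Context {R : realType}.
Implicit Types (f g h : R -> R[i]) (F : int -> R[i]).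

(** A sum over -n <= k <= n is indexed by j = k + n, so raising n by one shifts every index and adds
    a term at both ends. The inductions for symmetric sums go through this step. *)
Lemma symsumS (V : zmodType) (F : int -> V) n :
  \sum_(0 <= j < (2 * n.+1).+1) F (j%:Z - n.+1%:Z) =
  \sum_(0 <= j < (2 * n).+1) F (j%:Z - n%:Z) + (F n.+1%:Z + F (- n.+1%:Z)).
Proof.
rewrite (_ : (2 * n.+1)%N = (2 * n).+2); last by lia.
rewrite big_nat_recl // big_nat_recr //= sub0r.
rewrite [LHS]addrC -[LHS]addrA; congr (_ + (_ + _)).
  by apply: eq_bigr => i _; congr F; lia.
by congr F; lia.
Qed.

Lemma symsum0 (V : zmodType) (F : int -> V) :
  \sum_(0 <= j < (2 * 0).+1) F (j%:Z - 0%:Z) = F 0.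
Proof. by rewrite muln0 big_nat1. Qed.

Lemma symsum_supp (V : zmodType) (F : int -> V) n m : (n <= m)%N ->
  (forall k : int, (n < `|k|)%N -> F k = 0) ->
  \sum_(0 <= j < (2 * m).+1) F (j%:Z - m%:Z) =
  \sum_(0 <= j < (2 * n).+1) F (j%:Z - n%:Z).
Proof.
move=> nm F0; elim: m nm => [|m IH]; first by rewrite leqn0 => /eqP ->.
rewrite leq_eqVlt => /predU1P[->//|]; rewrite ltnS => nm.
by rewrite symsumS IH // !F0 ?addr0 //; lia.
Qed.

Lemma symsum_odd (V : zmodType) (F : int -> V) n : F 0 = 0 ->
  (forall k : int, F (- k) = - F k) ->
  \sum_(0 <= j < (2 * n).+1) F (j%:Z - n%:Z) = 0.
Proof.
move=> F0 FN; elim: n => [|n IH]; first by rewrite symsum0.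
by rewrite symsumS IH FN add0r subrr.
Qed.

Lemma symsum_delta (V : zmodType) (F : int -> V) n (k : int) :
  (forall j, j != k -> F j = 0) ->
  \sum_(0 <= j < (2 * n).+1) F (j%:Z - n%:Z) = if (`|k| <= n)%N then F k else 0.
Proof.
move=> Fk; elim: n => [|n IH].
  rewrite symsum0 leqn0 absz_eq0; case: eqVneq => [->//|k0].
  by rewrite Fk // eq_sym.
rewrite symsumS IH; have [kn|kn] := leqP `|k|%N n.
  rewrite (leqW kn) (Fk n.+1%:Z) ?(Fk (- n.+1%:Z)) ?addr0 //; apply/eqP; lia.
rewrite leq_eqVlt ltnS leqNgt kn orbF add0r.
case: eqP => kn1; last first.
  by rewrite (Fk n.+1%:Z) ?(Fk (- n.+1%:Z)) ?addr0 //; apply/eqP; lia.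
(* Here |k| = n + 1, so [k] is exactly one of the two new ends. *)
have [kE|k1] := eqVneq k n.+1%:Z.
  by rewrite (Fk (- n.+1%:Z)) ?addr0 -?kE //; apply/eqP; lia.
have kE : k = - n.+1%:Z by move/eqP: k1; lia.
by rewrite (Fk n.+1%:Z) ?add0r -?kE //; apply/eqP; lia.
Qed.

Lemma expiNM (k : int) (x : R) : expi (- (k%:~R * x)) = expi ((- k)%:~R * x).
Proof. by rewrite intrN mulNr. Qed.

Lemma fcoefE f k :
  fcoef f k = ((2 * pi)^-1)%:C%C * cint (fun x => f x * expi ((- k)%:~R * x)).
Proof. by rewrite /fcoef; congr (_ * _); apply: eq_cint => x; rewrite expiNM. Qed.

Lemma fcoefD f g k : cintble f -> cintble g ->
  fcoef (fun x => f x + g x) k = fcoef f k + fcoef g k.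
Proof.
move=> fi gi; rewrite !fcoefE -mulrDr -cintD; try exact: cintble_Mexpi.
by congr (_ * _); apply: eq_cint => x; rewrite mulrDl.
Qed.

Lemma fcoefZ c f k : cintble f -> fcoef (fun x => c * f x) k = c * fcoef f k.
Proof.
move=> fi; rewrite !fcoefE mulrCA -(cintZ c); last exact: cintble_Mexpi.
by congr (_ * _); apply: eq_cint => x; rewrite mulrA.
Qed.

Lemma fcoefB f g k : cintble f -> cintble g ->
  fcoef (fun x => f x - g x) k = fcoef f k - fcoef g k.
Proof.
move=> fi gi; rewrite -mulN1r -fcoefZ // -fcoefD //; last exact: cintbleZ.
by congr (fcoef _ k); apply/funext => x; rewrite mulN1r.
Qed.

Lemma fcoef_sum (I : Type) (r : seq I) (F : I -> R -> R[i]) k :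
  (forall i, cintble (F i)) ->
  fcoef (fun x => \sum_(i <- r) F i x) k = \sum_(i <- r) fcoef (F i) k.
Proof.
move=> iF; under eq_bigr do rewrite fcoefE.
rewrite fcoefE -mulr_sumr -cint_sum; last by move=> i; exact: cintble_Mexpi.
by congr (_ * _); apply: eq_cint => x; rewrite mulr_suml.
Qed.

Lemma fcoef_expi (j k : int) : fcoef (fun x : R => expi (j%:~R * x)) k = (j == k)%:R.
Proof.
rewrite fcoefE (@eq_cint _ _ (fun x => expi ((j - k)%:~R * x))) => [|x]; last first.
  by rewrite -expiD -mulrDl -intrD.
rewrite (_ : cint _ = ((j - k == 0)%:R * (2 * pi))%:C%C); last first.
  by rewrite /cint; congr Complex; [exact: Int_cos|exact: Int_sin].
rewrite -rmorphM subr_eq0 mulrCA mulVf ?mulr1; first by case: (j == k).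
by have := @pi_gt0 R; lra.
Qed.

Lemma fcoef_trigpol n a (k : int) :
  fcoef (@trigpol R n a) k = if (`|k| <= n)%N then a k else 0.
Proof.
rewrite /trigpol fcoef_sum => [|i]; last by apply: cintbleZ; exact: cintble_expi.
under eq_bigr do (rewrite fcoefZ ?fcoef_expi; last exact: cintble_expi).
rewrite (@symsum_delta _ (fun j => a j * (j == k)%:R) n k) ?eqxx ?mulr1 //.
by move=> j /negPf ->; rewrite mulr0.
Qed.

(** The coefficients at frequencies beyond n vanish, so the longer sum shrinks to the shorter one.
    This is why the mean of the S_m over n <= m < 2n fixes polynomials of degree n. *)
Lemma Sn_trigpol n m a : (n <= m)%N -> Sn (@trigpol R n a) m =1 trigpol n a.
Proof.
move=> nm x; rewrite /Sn {1}/trigpol; under eq_bigr do rewrite fcoef_trigpol.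
rewrite (@symsum_supp _ (fun k => (if (`|k| <= n)%N then a k else 0) *
   expi (k%:~R * x)) n m nm); last by move=> k nk; rewrite leqNgt nk mul0r.
apply: eq_big_nat => j jn; rewrite ifT //; lia.
Qed.

Lemma fcoef_subSn f n (k : int) : cintble f ->
  fcoef (fun x => f x - Sn f n x) k = if (`|k| <= n)%N then 0 else fcoef f k.
Proof.
move=> fi; rewrite fcoefB // ?fcoef_trigpol; last exact: cintble_trigpol.
by case: ifP; rewrite ?subrr ?subr0.
Qed.

Lemma SnB f g n x : cintble f -> cintble g ->
  Sn (fun x => f x - g x) n x = Sn f n x - Sn g n x.
Proof.
move=> fi gi; rewrite /Sn /trigpol -sumrB; apply: eq_bigr => j _.
by rewrite fcoefB // mulrBl.
Qed.

End FourierCoefficients.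

(** * L^1 boundedness of the de la Vallee Poussin means *)

Section DeLaValleePoussin.
Context {R : realType}.
Implicit Types (u : R -> R) (f g : R -> R[i]).

(** The Dirichlet kernel, the sum of e^{iky} over |k| <= m, kept real by writing cosines only: the
    sines cancel in pairs. The factor 1/(2 pi) is left to [SnE]. *)
Definition dirichlet m (y : R) : R :=
  \sum_(0 <= j < (2 * m).+1) cos ((j%:Z - m%:Z)%:~R * y).

Lemma dirichletE m y : dirichlet m y = 1 + 2 * \sum_(0 <= j < m) cos (j.+1%:R * y).
Proof.
rewrite /dirichlet; elim: m => [|m IH].
  by rewrite (symsum0 (fun k : int => cos (k%:~R * y))) big_geq // mul0r cos0 mulr0 addr0.
rewrite (symsumS (fun k : int => cos (k%:~R * y))) IH big_nat_recr //=.
by rewrite intrN mulNr cosN; ring.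
Qed.

(* The Fejer kernel is the square modulus of a geometric sum, hence nonnegative. *)
Lemma sum_dirichlet N y : \sum_(0 <= m < N) dirichlet m y =
  (\sum_(0 <= j < N) cos (j%:R * y)) ^+ 2 + (\sum_(0 <= j < N) sin (j%:R * y)) ^+ 2.
Proof.
elim: N => [|N IH]; first by rewrite !big_geq // expr0n addr0.
rewrite !big_nat_recr //= IH dirichletE.
set A := \sum_(0 <= j < N) cos (j%:R * y).
set B := \sum_(0 <= j < N) sin (j%:R * y).
(* Reversing the order of summation turns j + 1 into N - j, and cos((N - j)y) expands by the
   subtraction formula. This is the cross term in the squares of A + cos(Ny) and B + sin(Ny). *)
have -> : \sum_(0 <= j < N) cos (j.+1%:R * y) = A * cos (N%:R * y) + B * sin (N%:R * y).
  rewrite big_nat_rev /A /B !mulr_suml -big_split /=.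
  apply: eq_big_nat => j /andP[_ jN]; rewrite -cosB -mulrBl add0n -[RHS]cosN -mulNr opprB.
  by congr cos; congr (_ * _); rewrite -natrB 1?ltnW //; congr _%:R; lia.
by have := cos2Dsin2 (N%:R * y); lra.
Qed.

Lemma sum_dirichlet_ge0 N y : 0 <= \sum_(0 <= m < N) dirichlet m y.
Proof. by rewrite sum_dirichlet addr_ge0 ?sqr_ge0. Qed.

Definition conv m u (x : R) : R := Int (fun t => u t * dirichlet m (x - t)).

Lemma intbleM_cos u a : intble u -> intble (fun t => u t * cos (a * t)).
Proof.
move=> iu; apply: (@intble_bddM _ _ _ 1 iu (@continuous_cosM _ a)) => x.
exact: cos_max.
Qed.

Lemma intbleM_sin u a : intble u -> intble (fun t => u t * sin (a * t)).
Proof.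
move=> iu; apply: (@intble_bddM _ _ _ 1 iu (@continuous_sinM _ a)) => x.
exact: sin_max.
Qed.

Lemma cos_sub_expand u a x t : u t * cos (a * (x - t)) =
  cos (a * x) * (u t * cos (a * t)) + sin (a * x) * (u t * sin (a * t)).
Proof. by rewrite mulrBr cosB; ring. Qed.

Lemma intble_cos_sub u a x : intble u -> intble (fun t => u t * cos (a * (x - t))).
Proof.
move=> iu; under eq_fun do rewrite cos_sub_expand.
by apply: intbleD; apply: intbleZ; [exact: intbleM_cos|exact: intbleM_sin].
Qed.

Lemma intble_dirichlet u m x : intble u -> intble (fun t => u t * dirichlet m (x - t)).
Proof.
move=> iu; under eq_fun do rewrite mulr_sumr.
by apply: intble_sum => j; exact: intble_cos_sub.
Qed.

(* The kernel has finite rank, so exchanging integrals needs no Fubini theorem. *)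
Lemma convE u m x : intble u -> conv m u x =
  \sum_(0 <= j < (2 * m).+1)
     (Int (fun t => u t * cos ((j%:Z - m%:Z)%:~R * t)) * cos ((j%:Z - m%:Z)%:~R * x) +
      Int (fun t => u t * sin ((j%:Z - m%:Z)%:~R * t)) * sin ((j%:Z - m%:Z)%:~R * x)).
Proof.
move=> iu; rewrite /conv.
under eq_Int do rewrite mulr_sumr.
rewrite Int_sum => [|j]; last exact: intble_cos_sub.
apply: eq_bigr => j _; under eq_Int do rewrite cos_sub_expand.
have ic := intbleM_cos (j%:Z - m%:Z)%:~R iu; have is' := intbleM_sin (j%:Z - m%:Z)%:~R iu.
by rewrite IntD ?IntZ //; try exact: intbleZ; rewrite [cos _ * _]mulrC [sin _ * Int _]mulrC.
Qed.

Let intble_cos (a : R) : intble (fun x => cos (a * x)).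
Proof. by apply: intble_cont; exact: continuous_cosM. Qed.

Let intble_sin (a : R) : intble (fun x => sin (a * x)).
Proof. by apply: intble_cont; exact: continuous_sinM. Qed.

Lemma intble_conv u m : intble u -> intble (conv m u).
Proof.
move=> iu; rewrite (funext (fun x => convE m x iu)); apply: intble_sum => j.
by apply: intbleD; apply: intbleZ.
Qed.

(** Only the frequency 0 in [convE] has a nonzero integral over the period. For nonnegative [u] and
    a nonnegative sum of kernels this computes an L^1 norm. *)
Lemma Int_conv u m : intble u -> Int (conv m u) = 2 * pi * Int u.
Proof.
move=> iu; under eq_Int do rewrite convE //.
rewrite Int_sum => [|j]; last by apply: intbleD; apply: intbleZ.
pose F (k : int) : R := Int (fun t => u t * cos (k%:~R * t)) * ((k == 0)%:R * (2 * pi)).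
rewrite (eq_bigr (fun j : nat => F (j%:Z - m%:Z))) => [|j _]; last first.
  rewrite IntD; try by apply: intbleZ.
  by rewrite !IntZ // Int_cos Int_sin mulr0 addr0.
rewrite (@symsum_delta _ F m 0) => [|j /negPf j0]; last by rewrite /F j0 mul0r mulr0.
rewrite /F /=.
rewrite mul1r mulrC; congr (_ * _); apply: eq_Int => t.
by rewrite mul0r cos0 mulr1.
Qed.

(** The kernels with n <= m < 2n sum to the difference of the sums over m < 2n and over m < n. Both
    of these are nonnegative, so the modulus passes to [u] in each, and [Int_conv] gives the total
    2n + n = 3n. *)
Lemma vallee_poussin_real u n : intble u ->
  Int (fun x => `|\sum_(n <= m < 2 * n) conv m u x|) <=
  (3 * n)%:R * (2 * pi) * Int (fun x => `|u x|).
Proof.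
move=> iu; have iau := intble_norm iu.
have sumE v N x : intble v ->
    \sum_(0 <= m < N) conv m v x = Int (fun t => v t * \sum_(0 <= m < N) dirichlet m (x - t)).
  move=> iv; rewrite -Int_sum; last by move=> m; exact: intble_dirichlet.
  by apply: eq_Int => t; rewrite mulr_sumr.
have isum v N x : intble v -> intble (fun t => v t * \sum_(0 <= m < N) dirichlet m (x - t)).
  move=> iv; under eq_fun do rewrite mulr_sumr.
  by apply: intble_sum => m; exact: intble_dirichlet.
pose W x := \sum_(0 <= m < 2 * n) conv m (fun t => `|u t|) x +
            \sum_(0 <= m < n) conv m (fun t => `|u t|) x.
have -> : (3 * n)%:R * (2 * pi) * Int (fun x => `|u x|) = Int W.
  rewrite /W IntD; try by apply: intble_sum => m; exact: intble_conv.
  rewrite !Int_sum; try by move=> m; exact: intble_conv.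
  under eq_bigr do rewrite Int_conv //.
  under [X in _ + X]eq_bigr do rewrite Int_conv //.
  by rewrite !sumr_const_nat !subn0 -mulrnDr -[RHS]mulr_natl -[LHS]mulrA; congr (_%:R * _); lia.
apply: le_Int => [||x _].
- by apply/intble_norm/intble_sum => m; exact: intble_conv.
- by apply: intbleD; apply: intble_sum => m; exact: intble_conv.
have n2n : (n <= 2 * n)%N by lia.
have -> : \sum_(n <= m < 2 * n) conv m u x =
    \sum_(0 <= m < 2 * n) conv m u x - \sum_(0 <= m < n) conv m u x.
  by rewrite [X in _ = X - _](@big_cat_nat _ _ _ n) //= addrAC subrr add0r.
rewrite /W !sumE // (le_trans (ler_normB _ _)) //.
have bnd N : `|Int (fun t => u t * \sum_(0 <= m < N) dirichlet m (x - t))| <=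
    Int (fun t => `|u t| * \sum_(0 <= m < N) dirichlet m (x - t)).
  rewrite (le_trans (norm_Int (isum _ _ _ iu))) //.
  by apply: le_Int => [||t _]; [exact/intble_norm/isum|exact: isum|
    rewrite normrM [`|\sum_(_ <= _ < _) _|]ger0_norm // sum_dirichlet_ge0].
exact: lerD.
Qed.

(** The kernel is real, so the real and imaginary parts of [g] are convolved separately; this
    transfers the real estimate to [g]. *)
Lemma SnE g m x : cintble g ->
  Sn g m x = ((2 * pi)^-1)%:C%C * Complex (conv m (fun t => complex.Re (g t)) x)
                                        (conv m (fun t => complex.Im (g t)) x).
Proof.
move=> ig; have [g1 g2] := ig.
rewrite /Sn /trigpol.
have expand t : g t * (dirichlet m (x - t))%:C%C =
    \sum_(0 <= j < (2 * m).+1) expi ((j%:Z - m%:Z)%:~R * x) *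
                     (g t * expi ((- (j%:Z - m%:Z))%:~R * t)).
  rewrite (_ : (dirichlet m (x - t))%:C%C =
      \sum_(0 <= j < (2 * m).+1) expi ((j%:Z - m%:Z)%:~R * (x - t))).
    rewrite mulr_sumr; apply: eq_bigr => j _.
    by rewrite mulrCA -expiD intrN mulNr -mulrBr.
  (* The imaginary part is a sum of sines, odd in the frequency, over a symmetric range. *)
  apply/eqP; rewrite eq_complex Re_sum Im_sum /= eqxx /= eq_sym; apply/eqP.
  rewrite (@symsum_odd _ (fun k : int => sin (k%:~R * (x - t)))) //.
    by rewrite mul0r sin0.
  by move=> k; rewrite intrN mulNr sinN.
have -> : Complex (conv m (fun t => complex.Re (g t)) x)
    (conv m (fun t => complex.Im (g t)) x) =
    cint (fun t => g t * (dirichlet m (x - t))%:C%C).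
  by congr Complex; apply: eq_Int => t; rewrite ?ReM ?ImM /= mulr0 ?subr0 ?add0r.
under eq_cint do rewrite expand.
rewrite cint_sum => [|j]; last by apply: cintbleZ; exact: cintble_Mexpi.
rewrite mulr_sumr; apply: eq_bigr => j _.
by rewrite cintZ ?fcoefE; [ring|exact: cintble_Mexpi].
Qed.

(** The real and imaginary parts contribute 3n each, and the factor 2 pi cancels against the
    normalisation in [SnE]. *)
Lemma vallee_poussin g n : cintble g ->
  normL (fun x => \sum_(n <= m < 2 * n) Sn g m x) <= (6 * n)%:R * normL g.
Proof.
move=> ig; have [g1 g2] := ig; have ipi : 0 < (2 * pi)^-1 :> R.
  by rewrite invr_gt0; have := @pi_gt0 R; lra.
pose u x := \sum_(n <= m < 2 * n) conv m (fun t => complex.Re (g t)) x.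
pose v x := \sum_(n <= m < 2 * n) conv m (fun t => complex.Im (g t)) x.
have iu : intble u by apply: intble_sum => m; exact: intble_conv.
have iv : intble v by apply: intble_sum => m; exact: intble_conv.
have bnd w : intble w -> (forall x, `|w x| <= cmod (g x)) ->
    Int (fun x => `|\sum_(n <= m < 2 * n) conv m w x|) <= (3 * n)%:R * (2 * pi) * normL g.
  move=> iw wg; rewrite (le_trans (vallee_poussin_real n iw)) // ler_wpM2l //.
    by rewrite mulr_ge0 //; have := @pi_gt0 R; lra.
  by apply: le_Int => //; [exact: intble_norm|exact: intble_cmod].
apply: (@le_trans _ _ ((2 * pi)^-1 * Int (fun x => `|u x| + `|v x|))).
  apply: normL_le.
  - by apply: cintble_sum => m; exact: cintble_trigpol.
  - by apply: intbleD; exact: intble_norm.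
  move=> x _; under eq_bigr do rewrite SnE //.
  rewrite -mulr_sumr cmodM cmod_real gtr0_norm // ler_pM2l //.
  by rewrite (le_trans (cmod_le _)) // Re_sum Im_sum.
rewrite IntD; try exact: intble_norm.
have b1 := bnd _ g1 (fun x => Re_le_cmod _).
have b2 := bnd _ g2 (fun x => Im_le_cmod _).
rewrite mulrC ler_pdivrMr; last by have := @pi_gt0 R; lra.
apply: (le_trans (lerD b1 b2)); rewrite !natrM; lra.
Qed.

End DeLaValleePoussin.

(** * Logarithmic bound for the L^1 norm of geometric sums of exponentials *)

Section GeometricSums.
Context {R : realType}.
Implicit Types (x y s : R).

Lemma sin_mean_value y : 0 <= y -> exists2 c, 0 <= c <= y & sin y = cos c * y.
Proof.
move=> y0; have ds (x : R) : x \in `]0, y[%R -> is_derive x 1 sin (cos x).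
  by move=> _; exact: is_derive_sin.
have [c] := MVT_segment y0 ds (continuous_subspaceT (@continuous_sin R)).
by rewrite in_itv /= sin0 !subr0 => ? ->; exists c.
Qed.

Lemma norm_sin_le y : `|sin y| <= `|y|.
Proof.
wlog y0 : y / 0 <= y.
  move=> H; have [/H//|/ltW y0] := leP 0 y.
  by rewrite -normrN -sinN -(normrN y) H // oppr_ge0.
have [c _ ->] := sin_mean_value y0.
by rewrite normrM -[leRHS]mul1r ler_wpM2r // cos_max.
Qed.

(** If cos y >= 1/2, the mean value theorem gives sin y >= y/2. Otherwise sin^2 y > 3/4, while y/4 <
    1/2 because pi/2 < 2. *)
Lemma sin_ge y : 0 <= y <= pi / 2 -> y / 4 <= sin y.
Proof.
move=> /andP[y0 y1]; have p2 := @pihalf_lt2 R; have pp := @pi_gt0 R.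
have [cy|cy] := leP 2^-1 (cos y).
  have [c /andP[c0 cy'] ->] := sin_mean_value y0.
  suff : cos y <= cos c by move=> h; nra.
  rewrite leNgt ltr_cos ?in_itv /= -?leNgt //; apply/andP; split; lra.
have c0 : 0 <= cos y by apply: cos_ge0_pihalf; apply/andP; split; lra.
have s0 : 0 <= sin y by apply: sin_ge0_pi; apply/andP; split; lra.
have := cos2Dsin2 y; nra.
Qed.

Lemma sub1_expiM x a b : (a <= b)%N ->
  (1 - expi x) * \sum_(a <= k < b) expi (k%:R * x) = expi (a%:R * x) - expi (b%:R * x).
Proof.
elim: b => [|b IH]; first by rewrite leqn0 => /eqP ->; rewrite big_geq // subrr mulr0.
rewrite leq_eqVlt => /predU1P[->|]; first by rewrite big_geq // subrr mulr0.
rewrite ltnS => ab; rewrite big_nat_recr //= mulrDr IH //.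
by rewrite -natr1 [(_ + 1) * x]mulrDl mul1r expiD; ring.
Qed.

(** The modulus of [1 - expi x] is 2 sin(|x|/2), and [sin_ge] applies at |x|/2. *)
Lemma cmod_sub1_expi x : `|x| <= pi -> `|x| / 4 <= cmod (1 - expi x).
Proof.
move=> xpi; rewrite /cmod /=.
have -> : (1 - cos x) ^+ 2 + (0 - sin x) ^+ 2 = (2 * sin (`|x| / 2)) ^+ 2.
  have h := cos2Dsin2 x; have := cos_mulr2n (`|x| / 2).
  rewrite (_ : (`|x| / 2) *+ 2 = `|x|) ?cos_norm => [E|]; last by rewrite -mulr_natr divfK.
  by have := cos2Dsin2 (`|x| / 2); nra.
rewrite sqrtr_sqr (le_trans _ (ler_norm _)) //.
have x0 := normr_ge0 x.
by have : `|x| / 2 / 4 <= sin (`|x| / 2); [apply: sin_ge; apply/andP; split|]; lra.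
Qed.

(** The telescoped sum has modulus at most 2 and [cmod_sub1_expi] loses a factor 4, whence 8. The
    product form keeps x = 0 included. *)
Lemma cmod_geom_lin x a b : `|x| <= pi ->
  cmod (\sum_(a <= k < b) expi (k%:R * x)) * `|x| <= 8.
Proof.
move=> xpi; have [ba|/ltnW ab] := leqP b a; first by rewrite big_geq // cmod0 mul0r.
have := congr1 (@cmod R) (sub1_expiM x ab); rewrite cmodM => E.
have := cmodB (expi (a%:R * x)) (expi (b%:R * x)); rewrite -E !cmod_expi => le2.
have := cmod_sub1_expi xpi; have := cmod_ge0 (\sum_(a <= k < b) expi (k%:R * x)); nra.
Qed.

Lemma cmod_geom_card x a b : cmod (\sum_(a <= k < b) expi (k%:R * x)) <= (b - a)%:R.
Proof.
rewrite (le_trans (cmod_sum _ _ _)) //.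
by under eq_bigr do rewrite cmod_expi; rewrite sumr_const_nat.
Qed.

(** In contrast to [Int_FTC2], the hypotheses are local to the segment: the antiderivative ln(8 +
    ax) used next is differentiable only where its argument is positive. *)
Lemma Rintegral_FTC2 (u v : R -> R) a b : a < b ->
  (forall x : R, a <= x <= b -> {for x, continuous u}) ->
  (forall x : R, a <= x <= b -> is_derive x 1 v (u x)) ->
  Rintegral lebesgue_measure `[a, b] u = v b - v a.
Proof.
move=> ab cu dv.
have cv x : a <= x <= b -> {for x, continuous v}.
  move=> xab; apply: differentiable_continuous; apply/derivable1_diffP.
  by have [] := dv _ xab.
rewrite /Rintegral (@continuous_FTC2 _ _ v) //.
- by apply: continuous_in_subspaceT => x; rewrite inE /= in_itv /=; exact: cu.
- split.
  + by move=> x; rewrite in_itv /= => /andP[/ltW ? /ltW ?]; have [] := dv x _ => //; lra.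
  + by apply: cvg_at_right_filter; apply: cv; rewrite lexx ltW.
  + by apply: cvg_at_left_filter; apply: cv; rewrite lexx ltW.
- move=> x; rewrite in_itv /= derive1E => /andP[/ltW ? /ltW ?].
  by have [] := dv x _ => //; apply/andP.
Qed.

(** The integrand is comparable to min(N, 8/|x|), the combined bound for a geometric sum of N terms,
    and has a logarithmic antiderivative on each side of 0. *)
Lemma Int_majorant (N : R) : 0 < N ->
  intble (fun x => N / (8 + N * `|x|)) /\
  Int (fun x => N / (8 + N * `|x|)) = 2 * ln (1 + N * pi / 8).
Proof.
move=> N0; have pp := @pi_gt0 R.
have ci : intble (fun x => N / (8 + N * `|x|)).
  apply: intble_cont => x; apply: cvgM; first exact: cvg_cst.
  apply: cvgV; first by have := normr_ge0 x; nra.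
  apply: cvgD; first exact: cvg_cst.
  by apply: cvgM; [exact: cvg_cst|exact: norm_continuous].
split=> //.
have cq (a c x : R) : 0 < c + a * x -> {for x, continuous (fun x => N / (c + a * x))}.
  move=> ax; apply: cvgM; first exact: cvg_cst.
  apply: cvgV; first by rewrite gt_eqF.
  by apply: cvgD; [exact: cvg_cst|exact: mulrl_continuous].
have dq (a x : R) : 0 < 8 + a * x -> is_derive x 1 (fun x => ln (8 + a * x)) (a / (8 + a * x)).
  move=> ax; have ? := is_derive1_ln ax.
  by apply: is_derive_eq; rewrite add0r /GRing.scale /= mulr1 mulrC mul1r.
have right : Rintegral lebesgue_measure `[0, pi] (fun x => N / (8 + N * `|x|)) =
    ln (1 + N * pi / 8).
  transitivity (Rintegral lebesgue_measure `[0, pi] (fun x => N / (8 + N * x))).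
    apply: eq_Rintegral => x; by rewrite inE /= in_itv /= => /andP[x0 _]; rewrite ger0_norm.
  have d x : 0 <= x <= pi -> is_derive x 1 (fun x => ln (8 + N * x)) (N / (8 + N * x)).
    by move=> /andP[x0 _]; apply: dq; nra.
  rewrite (Rintegral_FTC2 pp _ d) => [|x /andP[x0 _]]; last by apply: cq; nra.
  rewrite mulr0 addr0 -ln_div ?posrE //; last by nra.
  by congr ln; field.
have left : Rintegral lebesgue_measure `[- pi, 0] (fun x => N / (8 + N * `|x|)) =
    ln (1 + N * pi / 8).
  transitivity (Rintegral lebesgue_measure `[- pi, 0] (fun x => N / (8 + - N * x))).
    apply: eq_Rintegral => x; by rewrite inE /= in_itv /= => /andP[_ x0]; rewrite ler0_norm // mulrN mulNr.
  have d x : - pi <= x <= 0 ->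
      is_derive x 1 (fun x => - ln (8 + - N * x)) (N / (8 + - N * x)).
    move=> /andP[_ x0]; have ? := dq (- N) x ltac:(nra).
    by apply: is_derive_eq; rewrite mulNr opprK.
  have Npi : - pi < 0 :> R by lra.
  rewrite (Rintegral_FTC2 Npi _ d) => [|x /andP[_ x0]]; last by apply: cq; nra.
  rewrite mulr0 addr0 opprK mulrNN addrC -ln_div ?posrE //; last by nra.
  by congr ln; field.
have := @Rintegral_itvB R (fun x => N / (8 + N * `|x|)) (BLeft (- pi)) (BRight pi) 0 ci.
rewrite !bnd_simp => /(_ ltac:(lra) ltac:(lra)).
rewrite left Rintegral_itv_obnd_cbnd; last first.
  by apply: integrableS ci => //; apply: subset_itvr; rewrite bnd_simp; lra.
by rewrite right /Int; lra.
Qed.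

Lemma normL_geom s n a b : `|s| = 1 -> (2 <= n)%N -> (b - a <= n)%N ->
  normL (fun x => \sum_(a <= k < b) expi (k%:R * (s * x))) <= 32 * ln n%:R.
Proof.
move=> s1 n2 abn; have pp := @pi_gt0 R; have p4 := @pihalf_lt2 R.
have n0 : 2 <= n%:R :> R by rewrite ler_nat.
have nn : 0 < n%:R :> R by lra.
have [iu Iu] := Int_majorant nn.
(* With g the modulus of the sum, g <= n and g|x| <= 8 combine to g(8 + n|x|) <= 16n. *)
apply: (@le_trans _ _ (16 * Int (fun x => n%:R / (8 + n%:R * `|x|)))).
  apply: normL_le => // [|x xpi].
    apply: cintble_sum => k; under eq_fun do rewrite mulrA; exact: cintble_expi.
  have sx : `|s * x| <= pi by rewrite normrM s1 mul1r ler_norml.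
  have := cmod_geom_lin a b sx; have := cmod_geom_card (s * x) a b.
  rewrite normrM s1 mul1r.
  have : (b - a)%:R <= n%:R :> R by rewrite ler_nat.
  move: (cmod _) => g bn gb gx; rewrite mulrA ler_pdivlMr; last first.
    by have := normr_ge0 x; nra.
  by have := normr_ge0 x; nra.
rewrite Iu mulrA (_ : 16 * 2 = 32); last by lra.
(* As pi/8 < 1/2 and n >= 2, the argument 1 + n pi/8 is at most n. *)
rewrite ler_wpM2l // ler_ln ?posrE; nra.
Qed.

End GeometricSums.

(** * Abel summation, bounded sine sums, and consequences of the NBVS condition *)

Section Summation.
Context {R : realType}.
Implicit Types (x s : R) (d : nat -> R[i]).

(** The boundary coefficient is [c b], one past the range of summation; variation plus boundary term
    is the quantity controlled by [NBVS_bounds]. *)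
Lemma abel_sum (K : pzRingType) (c e : nat -> K) a b : (a <= b)%N ->
  \sum_(a <= k < b) c k * e k =
  \sum_(a <= k < b) (c k - c k.+1) * (\sum_(a <= j < k.+1) e j) +
  c b * \sum_(a <= j < b) e j.
Proof.
elim: b => [|b IH].
  by rewrite leqn0 => /eqP ->; rewrite !big_geq // mulr0 addr0.
rewrite leq_eqVlt => /predU1P[->|]; first by rewrite !big_geq // mulr0 addr0.
rewrite ltnS => ab; rewrite !(big_nat_recr b) //= IH //.
by rewrite -!addrA -mulrDl subrK mulrDr.
Qed.

Lemma cmod_abel (c e : nat -> R[i]) (M : R) a b : (a <= b)%N ->
  (forall k, (a <= k <= b)%N -> cmod (\sum_(a <= j < k) e j) <= M) ->
  cmod (\sum_(a <= k < b) c k * e k) <=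
    (\sum_(a <= k < b) cmod (c k - c k.+1) + cmod (c b)) * M.
Proof.
move=> ab eM; rewrite abel_sum // (le_trans (cmodD _ _)) // mulrDl.
apply: lerD; last by rewrite cmodM ler_wpM2l ?cmod_ge0 // eM // ab leqnn.
rewrite (le_trans (cmod_sum _ _ _)) // mulr_suml.
apply: ler_sum_nat => k /andP[ak kb]; rewrite cmodM ler_wpM2l ?cmod_ge0 // eM //; lia.
Qed.

(** Since b - a <= n, every inner sum produced by Abel summation has at most n terms, so
    [normL_geom] bounds them all alike. The sign [s] lets one statement cover positive and negative
    frequencies. *)
Lemma normL_abel (c : nat -> R[i]) s n a b : `|s| = 1 -> (2 <= n)%N ->
  (a <= b <= a + n)%N ->
  normL (fun x => \sum_(a <= k < b) c k * expi (k%:R * (s * x))) <=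
    (\sum_(a <= k < b) cmod (c k - c k.+1) + cmod (c b)) * (32 * ln n%:R).
Proof.
move=> s1 n2 /andP[ab ban].
have ig k : cintble (fun x => \sum_(a <= j < k) expi (j%:R * (s * x))).
  by apply: cintble_sum => j; under eq_fun do rewrite mulrA; exact: cintble_expi.
rewrite (@eq_normL _ _ (fun x =>
    \sum_(a <= k < b) (c k - c k.+1) * (\sum_(a <= j < k.+1) expi (j%:R * (s * x))) +
    c b * \sum_(a <= j < b) expi (j%:R * (s * x)))); last by move=> x; rewrite abel_sum.
have iZ z k : cintble (fun x => z * \sum_(a <= j < k) expi (j%:R * (s * x))).
  exact: cintbleZ.
apply: (le_trans (normLD _ _)) => //; first exact: cintble_sum.
rewrite mulrDl; apply: lerD; last first.
  by rewrite normLZ // ler_wpM2l ?cmod_ge0 // normL_geom //; lia.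
rewrite (le_trans (normL_sum _ _)) // mulr_suml.
apply: ler_sum_nat => k /andP[ak kb].
by rewrite normLZ // ler_wpM2l ?cmod_ge0 // normL_geom //; lia.
Qed.

Lemma sum_inv_diff p n : (p <= n)%N ->
  \sum_(p.+1 <= k < n.+1) (k%:R^-1 - k.+1%:R^-1 : R) + n.+1%:R^-1 = p.+1%:R^-1.
Proof.
elim: n => [|n IH]; first by rewrite leqn0 => /eqP ->; rewrite big_geq // add0r.
rewrite leq_eqVlt => /predU1P[->|]; first by rewrite big_geq // add0r.
by rewrite ltnS => pn; rewrite big_nat_recr //= -addrA subrK IH.
Qed.

(** The sum is cut at p, the smaller of n and the integer part of 1/|x|. Each of the first p terms
    is at most |x|, and p|x| <= 1. On a nonempty tail, Abel summation gives 1/(p + 1) times 8/|x|,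
    at most 8 because (p + 1)|x| > 1. *)
Lemma sum_sin_bounded n x : `|x| <= pi ->
  `|\sum_(1 <= k < n.+1) k%:R^-1 * sin (k%:R * x)| <= 9.
Proof.
move=> xpi; have [->|x0] := eqVneq x 0.
  by rewrite big1 ?normr0 // => k _; rewrite mulr0 sin0 mulr0.
have ax0 : 0 < `|x| by rewrite normr_gt0.
pose p := minn n (Num.trunc `|x|^-1).
have head : `|\sum_(1 <= k < p.+1) k%:R^-1 * sin (k%:R * x)| <= 1.
  rewrite (le_trans (ler_norm_sum _ _ _)) //.
  apply: (@le_trans _ _ (\sum_(1 <= k < p.+1) `|x|)).
    apply: ler_sum_nat => k /andP[k0 _]; have kk : 0 < k%:R :> R by rewrite ltr0n.
    rewrite normrM gtr0_norm ?invr_gt0 // mulrC ler_pdivrMr //.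
    by rewrite (le_trans (norm_sin_le _)) // normrM (gtr0_norm kk) mulrC.
  rewrite sumr_const_nat subSS subn0 -mulr_natl -ler_pdivlMr // mul1r.
  have : (Num.trunc `|x|^-1)%:R <= `|x|^-1 by rewrite truncn_le // invr_ge0.
  by apply: le_trans; rewrite ler_nat geq_minr.
have pn : (p <= n)%N by rewrite geq_minl.
rewrite (@big_cat_nat _ _ _ p.+1) //= (le_trans (ler_normD _ _)) //.
rewrite (_ : 9 = 1 + 8); last by lra.
apply: lerD => //.
have [pE|pn'] : p = n \/ p = Num.trunc `|x|^-1 by rewrite /p /minn; case: ifP; [left|right].
  by rewrite pE big_geq // normr0.
pose c k : R[i] := (k%:R^-1)%:C%C.
apply: (@le_trans _ _ (cmod (\sum_(p.+1 <= k < n.+1) c k * expi (k%:R * x)))).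
  apply: le_trans (Im_le_cmod _); rewrite Im_sum.
  by under [in leRHS]eq_bigr do rewrite ImM /= mul0r addr0.
have bM k : (p.+1 <= k <= n.+1)%N ->
    cmod (\sum_(p.+1 <= j < k) expi (j%:R * x)) <= 8 / `|x|.
  by move=> _; rewrite ler_pdivlMr // cmod_geom_lin.
apply: (le_trans (cmod_abel c _ bM)) => //.
rewrite (_ : \sum_(_ <= k < _) _ + _ = p.+1%:R^-1).
  rewrite mulrCA ger_pMr // -invfM invf_le1 ?mulr_gt0 // -ler_pdivrMr // mul1r.
  by rewrite pn' ltW // truncnS_gt.
rewrite -(sum_inv_diff pn) /c cmod_real ger0_norm ?invr_ge0 //; congr (_ + _).
apply: eq_big_nat => k /andP[k0 _]; rewrite -rmorphB cmod_real ger0_norm //.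
by rewrite subr_ge0 lef_pV2 ?posrE ?ltr0n ?ler_nat //; lia.
Qed.

(** Each induction step is ln(1 + 1/(n+1)) <= 1/(n+1). This is the source of the logarithm in the
    necessity part. *)
Lemma harmonic_ge_ln n : ln n.+1%:R <= \sum_(1 <= k < n.+1) (k%:R^-1 : R).
Proof.
elim: n => [|n IH]; first by rewrite big_geq // ln1.
rewrite big_nat_recr //= (le_trans _ (lerD IH (lexx _))) //.
have n0 : 0 < n.+1%:R :> R by rewrite ltr0n.
have -> : n.+2%:R = n.+1%:R * (1 + n.+1%:R^-1) :> R.
  by rewrite mulrDr mulr1 mulfV ?gt_eqF // natr1.
have i0 : 0 < n.+1%:R^-1 :> R by rewrite invr_gt0.
have i1 : 0 < 1 + n.+1%:R^-1 :> R by rewrite ltr_wpDr // ltW.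
by rewrite lnM ?posrE // lerD2l le_ln1Dx // (lt_trans _ i0) // ltrN10.
Qed.

(** Serves to absorb the coefficients of index 2n + 2k, the right ends of the NBVS blocks, into a
    weighted sum over all indices 2n + k. *)
Lemma sum_even_le (a : nat -> R) n : (forall k, 0 <= a k) ->
  \sum_(1 <= k < n.+1) a (2 * k)%N <= \sum_(1 <= k < (2 * n).+1) a k.
Proof.
move=> a0; elim: n => [|n IH]; first by rewrite !big_geq.
rewrite (_ : (2 * n.+1).+1 = (2 * n).+3); last by lia.
rewrite big_nat_recr // (big_nat_recr (2 * n).+2) // (big_nat_recr (2 * n).+1) //=.
rewrite (_ : (2 * n.+1)%N = (2 * n).+2); last by lia.
by rewrite lerD2r (le_trans IH) // lerDl.
Qed.

(** In the sector |Im z| <= tan(theta) Re z, with a finite tangent because theta < pi/2; so B = 1 +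
    tan(theta). *)
Lemma inM_sector (theta : R) : 0 <= theta < pi / 2 ->
  exists2 B : R, 0 < B & forall z, inM theta z -> cmod z <= B * complex.Re z.
Proof.
move=> /andP[t0 tp]; have pp := @pi_gt0 R.
have tan0' : 0 <= tan theta.
  by rewrite /tan divr_ge0 ?sin_ge0_pi ?cos_ge0_pihalf //; apply/andP; split; lra.
exists (1 + tan theta); first by lra.
move=> z [->|[rz]]; first by rewrite cmod0 mulr0.
set q := _ / _ => aq.
have qt : `|q| <= tan theta.
  have -> : `|q| = tan `|atan q|.
    have [q0|/ltW q0] := leP 0 q.
      by rewrite !ger0_norm ?atanK // -atan0 le_atan.
    by rewrite !ler0_norm ?tanN ?atanK // -atan0 le_atan.
  rewrite leNgt ltr_tan -?leNgt // in_itv /=; apply/andP; split; try lra.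
  by have := normr_ge0 (atan q); lra.
rewrite (le_trans (cmod_le _)) // mulrDl mul1r gtr0_norm // lerD2l.
by rewrite -ler_pdivrMr // -[leLHS](_ : `|q| = _) // /q normrM normfV (gtr0_norm rz).
Qed.

Lemma NBVS_sector d : NBVS d ->
  exists2 B : R, 0 < B & forall n, (1 <= n)%N -> cmod (d n) <= B * complex.Re (d n).
Proof.
move=> [[theta tt dM] _]; have [B B0 HB] := inM_sector tt.
by exists B => // n n1; apply/HB/dM.
Qed.

Lemma cmod_telescope d m l : (m <= l)%N ->
  cmod (d l) <= cmod (d m) + \sum_(m <= n < l) cmod (d n - d n.+1).
Proof.
elim: l => [|l IH]; first by rewrite leqn0 => /eqP ->; rewrite big_geq // addr0.
rewrite leq_eqVlt => /predU1P[->|]; first by rewrite big_geq // addr0.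
rewrite ltnS => ml; rewrite big_nat_recr //= addrA.
have := IH ml; have := cmodB (d l) (d l - d l.+1); rewrite opprB (addrC (d l) (_ - d l)) subrK; lra.
Qed.

(** The variation over [a, b] is at most that over the whole block, and |d_b| is at most |d_m| plus
    it, whence 2K + 1. The end b = 2m + 1 is allowed because the NBVS sum includes the difference at
    2m. Taking a = b bounds a single term. *)
Lemma NBVS_bounds d : NBVS d -> exists2 K : R, 0 < K &
  forall m a b, (1 <= m)%N -> (m <= a <= b)%N -> (b <= (2 * m).+1)%N ->
    \sum_(a <= n < b) cmod (d n - d n.+1) + cmod (d b) <=
      K * (cmod (d m) + cmod (d (2 * m)%N)).
Proof.
move=> [_ [K K0 HK]]; exists (2 * K + 1); first by lra.
move=> m a b m1 /andP[ma ab] bm; have := HK m m1.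
have part l : (m <= l <= (2 * m).+1)%N -> \sum_(m <= n < l) cmod (d n - d n.+1) <=
    \sum_(m <= n < (2 * m).+1) cmod (d n - d n.+1).
  move=> /andP[ml lm]; rewrite [leRHS](@big_cat_nat _ _ _ l m) //= lerDl sumr_ge0 // => n _.
  exact: cmod_ge0.
have := part b; rewrite (leq_trans ma ab) bm => /(_ isT).
have := cmod_telescope d (leq_trans ma ab).
have : \sum_(a <= n < b) cmod (d n - d n.+1) <= \sum_(m <= n < b) cmod (d n - d n.+1).
  rewrite [leRHS](@big_cat_nat _ _ _ a m) //= lerDr sumr_ge0 // => n _.
  exact: cmod_ge0.
by have := cmod_ge0 (d m); have := cmod_ge0 (d (2 * m)%N); nra.
Qed.

End Summation.

(** * Coefficient bounds for necessity, block and mean estimates for sufficiency *)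

Section Estimates.
Context {R : realType}.
Implicit Types (f g h : R -> R[i]) (d : nat -> R[i]) (psi : nat -> R).

Lemma expi_subN (y : R) : expi (- y) - expi y = Complex 0 (- 2 * sin y).
Proof.
by apply/eqP; rewrite eq_complex /= cosN sinN subrr eqxx /=; apply/eqP; ring.
Qed.

(* Fejer's polynomial [sum_(k <= n) sin (k x) / k], modulated by [n], is bounded and sees
   only the Fourier coefficients of [f - Sn f n] at the frequencies [n + k]. *)
Lemma fejer_test f (s : int) n : cintble f -> `|s|%N = 1%N ->
  cmod (\sum_(1 <= k < n.+1) (k%:R^-1)%:C%C * fcoef f (s * (n + k)%N%:Z)) <=
  36 * normL (fun x => f x - Sn f n x).
Proof.
move=> fi s1; set h := fun x => f x - Sn f n x.
have hi : cintble h by apply: cintbleB => //; exact: cintble_trigpol.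
pose e (k : int) (x : R) : R[i] := expi ((- (s * k))%:~R * x).
pose phi x := \sum_(1 <= k < n.+1)
  (k%:R^-1)%:C%C * (e (n%:Z + k%:Z) x - e (n%:Z - k%:Z) x).
have ei k : cintble (fun x => h x * e k x) by exact: cintble_Mexpi.
have hphiE x : h x * phi x = \sum_(1 <= k < n.+1)
    (k%:R^-1)%:C%C * (h x * e (n%:Z + k%:Z) x + (-1) * (h x * e (n%:Z - k%:Z) x)).
  by rewrite mulr_sumr; apply: eq_bigr => k _; ring.
have ti k : cintble (fun x => (k%:R^-1)%:C%C *
    (h x * e (n%:Z + k%:Z) x + (-1) * (h x * e (n%:Z - k%:Z) x))).
  by apply/cintbleZ/cintbleD => //; exact: cintbleZ.
have hphii : cintble (fun x => h x * phi x).
  by rewrite (funext hphiE); exact: cintble_sum.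
have -> : \sum_(1 <= k < n.+1) (k%:R^-1)%:C%C * fcoef f (s * (n + k)%N%:Z) =
    ((2 * pi)^-1)%:C%C * cint (fun x => h x * phi x).
  rewrite (eq_cint hphiE) cint_sum // mulr_sumr.
  apply: eq_big_nat => k /andP[k1 kn].
  have F1 : fcoef h (s * (n + k)%N%:Z) = fcoef f (s * (n + k)%N%:Z).
    by rewrite fcoef_subSn // ifF //; rewrite abszM s1; lia.
  (* For 1 <= k <= n the frequency n - k lies in [0, n), where subtracting S_n has removed
     everything. *)
  have F2 : fcoef h (s * (n%:Z - k%:Z)) = 0.
    by rewrite fcoef_subSn // ifT //; rewrite abszM s1; lia.
  rewrite cintZ; last by apply: cintbleD => //; exact: cintbleZ.
  rewrite cintD //; last exact: cintbleZ.
  rewrite cintZ // [RHS]mulrCA mulrDr (mulrCA _ (-1)) -F1.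
  have <- : fcoef h (s * (n + k)%N%:Z) = ((2 * pi)^-1)%:C%C *
      cint (fun x => h x * e (n%:Z + k%:Z) x) by rewrite fcoefE PoszD.
  have <- : fcoef h (s * (n%:Z - k%:Z)) = ((2 * pi)^-1)%:C%C *
      cint (fun x => h x * e (n%:Z - k%:Z) x) by rewrite fcoefE.
  by rewrite F2 mulr0 addr0.
have sR : `|s%:~R| = 1 :> R by rewrite -intr_norm -abszE s1.
(* Factoring out the unimodular [e n%:Z x] leaves -2i times the sine sum, bounded by 9. *)
have phi_le x : - pi <= x <= pi -> cmod (phi x) <= 18.
  move=> xpi; pose y := s%:~R * x.
  have ypi : `|y| <= pi by rewrite normrM sR mul1r ler_norml.
  have -> : phi x = e n%:Z x * Complex 0 (-2 * \sum_(1 <= k < n.+1) k%:R^-1 * sin (k%:R * y)).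
    rewrite (_ : Complex _ _ = \sum_(1 <= k < n.+1)
        (k%:R^-1)%:C%C * (expi (- (k%:R * y)) - expi (k%:R * y))); last first.
      apply/eqP; rewrite eq_complex Re_sum Im_sum; apply/andP; split; apply/eqP.
        by rewrite [RHS]big1 // => k _; rewrite expi_subN ReM /=; ring.
      rewrite [LHS]/= mulr_sumr; apply: eq_bigr => k _.
      by rewrite expi_subN ImM /=; ring.
    rewrite mulr_sumr; apply: eq_bigr => k _; rewrite mulrCA; congr (_ * _).
    rewrite mulrBr -!expiD; congr (expi _ - expi _); rewrite /y !rmorphN !rmorphM /=.
      by rewrite rmorphD /=; ring.
    by rewrite rmorphB /=; ring.
  rewrite cmodM cmod_expi mul1r (le_trans (cmod_le _)) //= normr0 add0r normrM.
  by rewrite normrN (ger0_norm (ler0n R 2)); have := sum_sin_bounded n ypi; lra.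
have : normL (fun x => h x * phi x) <= 18 * normL h.
  apply: normL_le => // [|x xpi]; first exact: intble_cmod.
  by rewrite cmodM mulrC ler_wpM2r ?cmod_ge0 // phi_le.
(* The constant 36 is 18 times the 2 of [cmod_cint]; the prefactor 1/(2 pi) is bounded by 1. *)
have := cmod_cint hphii; have pp := @pi_ge2 R.
have ip : 0 < (2 * pi)^-1 :> R by rewrite invr_gt0; lra.
have ip1 : (2 * pi)^-1 <= 1 :> R by rewrite invf_le1; lra.
rewrite cmodM cmod_real gtr0_norm // => c1 c2.
have := cmod_ge0 (cint (fun x => h x * phi x)); nra.
Qed.

(** Doubling is applied twice: for odd n one doubling of the half only reaches n - 1, whereas two go
    past n, and monotonicity concludes. *)
Lemma doubling_half psi :
  (forall n, (1 <= n)%N -> 0 < psi n) ->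
  (forall n m, (1 <= n <= m)%N -> psi m <= psi n) ->
  (exists C : R, forall n, (1 <= n)%N -> psi n <= C * psi (2 * n)%N) ->
  exists2 C : R, 0 <= C & forall n, (2 <= n)%N -> psi n./2 <= C * psi n.
Proof.
move=> p0 pdec [C HC]; exists (`|C| * `|C|); first exact: mulr_ge0.
have step n : (1 <= n)%N -> psi n <= `|C| * psi (2 * n)%N.
  move=> n1; rewrite (le_trans (HC n n1)) // ler_wpM2r ?ler_norm // ltW // p0 //; lia.
move=> n n2; have h1 : (1 <= n./2)%N by lia.
rewrite (le_trans (step _ h1)) // -mulrA ler_wpM2l //.
rewrite (le_trans (step (2 * n./2)%N _)) ?ler_wpM2l ?pdec //; lia.
Qed.

Lemma NBVS_log_bound d psi : NBVS d ->
  (forall n, (1 <= n)%N -> 0 < psi n) ->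
  (forall n m, (1 <= n <= m)%N -> psi m <= psi n) ->
  (exists C : R, forall n, (1 <= n)%N -> psi n <= C * psi (2 * n)%N) ->
  (exists C : R, exists N : nat, forall n, (N <= n)%N ->
     cmod (\sum_(1 <= k < n.+1) (k%:R^-1)%:C%C * d (n + k)%N) <= C * psi n) ->
  exists C : R, exists N : nat, forall n, (N <= n)%N ->
    cmod (d n) * ln n%:R <= C * psi n.
Proof.
move=> dN p0 pdec pdbl [C0 [N0 HC0]]; have [C Cge0 HC] := doubling_half p0 pdec pdbl.
have [K K0 HK] := NBVS_bounds dN; have [B B0 HB] := NBVS_sector dN.
pose S n := \sum_(1 <= k < n.+1) k%:R^-1 * cmod (d (n + k)%N).
(* The sector condition replaces each modulus by B times a real part, and real parts add without
   cancellation. *)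
have SC n : (N0 <= n)%N -> S n <= B * (C0 * psi n).
  move=> Nn; apply: (@le_trans _ _ (B * complex.Re
      (\sum_(1 <= k < n.+1) (k%:R^-1)%:C%C * d (n + k)%N))); last first.
    rewrite ler_wpM2l ?(ltW B0) // (le_trans _ (HC0 _ Nn)) //.
    by rewrite (le_trans (ler_norm _)) // Re_le_cmod.
  rewrite Re_sum mulr_sumr; apply: ler_sum_nat => k /andP[k1 _].
  rewrite ReM /= mul0r subr0 mulrCA ler_wpM2l ?invr_ge0 //; apply: HB; lia.
(* The 2 comes from ln N <= 2 ln(n + 1) with n the half of N, the 3 from [S n + 2 * S (2 * n)], and
   C from returning from psi at n to psi at N. The threshold makes n at least N0 and at least 1. *)
exists (2 * K * (B * `|C0|) * 3 * C), (2 * N0).+2 => N Nn.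
have psiN := HC N (leq_trans (isT : (1 < (2 * N0).+2)%N) Nn).
have [n1 n0N n2N Nn2] :
    [/\ (1 <= N./2)%N, (N0 <= N./2)%N, (2 * N./2 <= N)%N & (N <= 2 * N./2 + 1)%N].
  by clear -Nn; split; lia.
move: psiN n1 n0N n2N Nn2; set n := N./2 => psiN n1 n0N n2N Nn2.
have n2n : (n <= 2 * n)%N by rewrite leq_pmull.
have Nsq : (N <= n.+1 ^ 2)%N by clear -Nn2; nia.
(* For 1 <= k <= n, N lies between n + k and 2(n + k), so |d_N| is bounded by the two end terms.
   These are summed with weight 1/k. In the second family 1/k = 2/(2k), so it is twice the
   even-indexed part of [S (2 * n)]. *)
have key : cmod (d N) * \sum_(1 <= k < n.+1) k%:R^-1 <= K * (S n + 2 * S (2 * n)%N).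
  apply: (@le_trans _ _ (\sum_(1 <= k < n.+1)
      k%:R^-1 * (K * (cmod (d (n + k)%N) + cmod (d (2 * n + 2 * k)%N))))).
    rewrite mulr_sumr; apply: ler_sum_nat => k /andP[k1 kn].
    rewrite mulrC ler_wpM2l ?invr_ge0 //.
    have := HK (n + k)%N N N; rewrite big_geq // add0r mulnDr.
    by apply; clear -k1 kn n1 n2N Nn2; lia.
  under eq_bigr do rewrite mulrCA mulrDr.
  rewrite -mulr_sumr ler_wpM2l ?(ltW K0) // big_split /= lerD2l.
  pose a k := k%:R^-1 * cmod (d (2 * n + k)%N).
  have /(sum_even_le n) : forall k, 0 <= a k.
    by move=> k; rewrite mulr_ge0 ?invr_ge0 ?cmod_ge0.
  rewrite -(ler_pM2l (ltr0n R 2)); apply: le_trans; rewrite mulr_sumr.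
  apply: ler_sum_nat => k /andP[k1 _]; rewrite /a natrM invfM !mulrA mulfV // mul1r.
  exact: lexx.
have s1 := SC n n0N; have s2 := SC (2 * n)%N (leq_trans n0N n2n).
have q1 : psi (2 * n)%N <= psi n by rewrite pdec // n1.
(* N <= 2n + 1 <= (n + 1)^2. *)
have Nb : ln N%:R <= 2 * \sum_(1 <= k < n.+1) (k%:R^-1 : R).
  apply: (@le_trans _ _ (2 * ln n.+1%:R)); last by rewrite ler_wpM2l ?harmonic_ge_ln.
  rewrite mulr_natl -lnXn ?ltr0n // -natrX ler_ln ?posrE ?ltr0n ?ler_nat ?expn_gt0 //.
  exact: leq_trans Nn.
have pn := p0 n n1; have p2n := p0 (2 * n)%N (leq_trans n1 n2n).
have C0le (t : R) : 0 <= t -> B * (C0 * t) <= B * `|C0| * t.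
  by move=> t0; rewrite -mulrA ler_wpM2l ?(ltW B0) // ler_wpM2r // ler_norm.
have e1 := C0le _ (ltW pn); have e2 := C0le _ (ltW p2n).
have M0 : 0 <= B * `|C0| by rewrite mulr_ge0 // ltW.
have e3 : B * `|C0| * psi (2 * n)%N <= B * `|C0| * psi n by rewrite ler_wpM2l.
have SS : S n + 2 * S (2 * n)%N <= 3 * (B * `|C0| * psi n) by lra.
apply: (@le_trans _ _ (2 * (K * (3 * (B * `|C0| * psi n))))).
  apply: (@le_trans _ _ (cmod (d N) * (2 * \sum_(1 <= k < n.+1) k%:R^-1))).
    by rewrite ler_wpM2l ?cmod_ge0.
  rewrite mulrCA ler_wpM2l // (le_trans key) // ler_wpM2l // ltW //.
rewrite (_ : 2 * K * _ * _ * _ * _ =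
  2 * (K * (3 * (B * `|C0| * (C * psi N))))); last by ring.
by do !rewrite ler_wpM2l ?(ltW K0) //.
Qed.

(** Abel summation and [NBVS_bounds] leave K(|d_n| + |d_{2n}|) times 32 ln n. The assumed bound
    applies at both ends, using ln n <= ln(2n) and the monotonicity of [psi] for the second. *)
Lemma normL_frequency_block d psi (s : R) : `|s| = 1 -> NBVS d ->
  (forall n, (1 <= n)%N -> 0 < psi n) ->
  (forall n m, (1 <= n <= m)%N -> psi m <= psi n) ->
  (exists C : R, exists N : nat, forall n, (N <= n)%N ->
    cmod (d n) * ln n%:R <= C * psi n) ->
  exists C : R, exists N : nat, forall n m, (N <= n)%N -> (n <= m < 2 * n)%N ->
    normL (fun x => \sum_(n.+1 <= k < m.+1) d k * expi (k%:R * (s * x))) <= C * psi n.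
Proof.
move=> s1 dN p0 pdec [C [N HC]]; have [K K0 HK] := NBVS_bounds dN.
exists (K * (32 * (2 * `|C|))), (N + 2)%N => n m Nn nm.
have [n2 Nn1 n2n] : [/\ (2 <= n)%N, (N <= n)%N & (n <= 2 * n)%N].
  by clear -Nn; split; lia.
have [blk bm m2] : [/\ (n.+1 <= m.+1 <= n.+1 + n)%N, (n <= n.+1 <= m.+1)%N &
    (m.+1 <= (2 * n).+1)%N] by clear -nm; split; lia.
have nR : 2 <= n%:R :> R by rewrite ler_nat.
rewrite (le_trans (normL_abel d s1 n2 blk)) //.
have := HK n n.+1 m.+1 (ltnW n2) bm m2.
set V := (_ + _) => Vle.
have ln0 : 0 <= ln n%:R :> R by rewrite ln_ge0 // (le_trans _ nR) // ler1n.
(* [C] may be negative, so its absolute value is taken before comparing values of [psi]. *)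
have Cle k : (n <= k)%N -> C * psi k <= `|C| * psi n.
  move=> nk; have pk := p0 k (leq_trans (ltnW n2) nk).
  apply: (@le_trans _ _ (`|C| * psi k)); first by rewrite ler_wpM2r ?ler_norm // ltW.
  by rewrite ler_wpM2l // pdec // (ltnW n2).
have a1 : cmod (d n) * ln n%:R <= `|C| * psi n.
  by rewrite (le_trans (HC n Nn1)) // Cle.
have a2 : cmod (d (2 * n)%N) * ln n%:R <= `|C| * psi n.
  apply: le_trans (Cle (2 * n)%N n2n); apply: le_trans (HC (2 * n)%N (leq_trans Nn1 n2n)).
  have n0 := ltnW n2.
  by rewrite ler_wpM2l ?cmod_ge0 // ler_ln ?posrE ?ltr0n ?ler_nat // muln_gt0.
apply: (@le_trans _ _ (K * (cmod (d n) + cmod (d (2 * n)%N)) * (32 * ln n%:R))).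
  by rewrite ler_wpM2r // mulr_ge0.
rewrite -!mulrA ler_wpM2l ?(ltW K0) //; clear -a1 a2; lra.
Qed.

Lemma SnB_blocks f n m x : (n <= m)%N ->
  Sn f m x - Sn f n x =
  \sum_(n.+1 <= k < m.+1) fcoef f k%:Z * expi (k%:R * (1 * x)) +
  \sum_(n.+1 <= k < m.+1) fcoef f (- k%:Z) * expi (k%:R * (-1 * x)).
Proof.
rewrite /Sn /trigpol; elim: m => [|m IH].
  by rewrite leqn0 => /eqP ->; rewrite subrr !big_geq // addr0.
rewrite leq_eqVlt => /predU1P[->|]; first by rewrite subrr !big_geq // addr0.
rewrite ltnS => nm.
rewrite (symsumS (fun k : int => fcoef f k * expi (k%:~R * x))) addrAC IH //.
rewrite !(big_nat_recr m.+1) //= mul1r mulN1r intrN mulNr mulrN; ring.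
Qed.

(** Put T = [trigpol n a] and g = f - T. As S_m g = S_m f - T for m >= n, n(f - S_n f) equals n g
    minus the sum of the S_m g, plus the sum of the S_m f - S_n f, over n <= m < 2n. The first two
    pieces cost n + 6n = 7n norms of g, the last one nA. *)
Lemma deviation_le f n a (A : R) : cintble f -> (1 <= n)%N ->
  (forall m, (n <= m < 2 * n)%N -> normL (fun x => Sn f m x - Sn f n x) <= A) ->
  normL (fun x => f x - Sn f n x) <= 7 * normL (fun x => f x - trigpol n a x) + A.
Proof.
move=> fi n1 HA; set g := fun x => f x - trigpol n a x.
have ti m (h : R -> R[i]) : cintble (Sn h m) by exact: cintble_trigpol.
have gi : cintble g by apply: cintbleB => //; exact: cintble_trigpol.
have dB m : cintble (fun x => Sn f m x - Sn f n x) by exact: cintbleB.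
have E x : n%:R * (f x - Sn f n x) =
    (n%:R * g x - \sum_(n <= m < 2 * n) Sn g m x) +
    \sum_(n <= m < 2 * n) (Sn f m x - Sn f n x).
  have -> : \sum_(n <= m < 2 * n) Sn g m x =
      \sum_(n <= m < 2 * n) (Sn f m x - trigpol n a x).
    apply: eq_big_nat => m /andP[nm _].
    by rewrite -(Sn_trigpol a nm); apply: SnB => //; exact: cintble_trigpol.
  rewrite !sumrB !sumr_const_nat (_ : (2 * n - n)%N = n); last by rewrite mul2n -addnn addnK.
  rewrite -[trigpol _ _ _ *+ _]mulr_natl -[Sn _ _ _ *+ _]mulr_natl /g; ring.
have nR : 0 < n%:R :> R by rewrite ltr0n.
have n2n : (2 * n - n)%N = n by rewrite mul2n -addnn addnK.
have nC : cmod (n%:R : R[i]) = n%:R.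
  by rewrite -[n%:R](rmorph_nat (real_complex R)) cmod_real normr_nat.
rewrite -(ler_pM2l nR) -[X in X * normL _ <= _]nC -normLZ; last exact: cintbleB.
rewrite (eq_normL E).
have Si : cintble (fun x => \sum_(n <= m < 2 * n) Sn g m x) by exact: cintble_sum.
have ngi : cintble (fun x => n%:R * g x) by exact: cintbleZ.
apply: (le_trans (normLD _ _)); [exact: cintbleB|exact: cintble_sum|].
rewrite mulrDr; apply: lerD.
  apply: (le_trans (normLB ngi Si)); rewrite normLZ // nC.
  by have := vallee_poussin n gi; rewrite natrM; lra.
rewrite (le_trans (normL_sum _ _)) //.
apply: (@le_trans _ _ (\sum_(n <= m < 2 * n) A)); first exact: ler_sum_nat.
by rewrite sumr_const_nat mulr_natl n2n.
Qed.

End Estimates.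

(** * The best approximation error as an infimum *)

Section BestApproximation.
Context {R : realType}.
Implicit Types f : R -> R[i].

Let has_lbound_En f n :
  has_lbound [set normL (fun x => f x - trigpol n a x) | a in [set: int -> R[i]]].
Proof. by exists 0 => _ [a _ <-]; exact: normL_ge0. Qed.

Lemma En_le f n a : En f n <= normL (fun x => f x - trigpol n a x).
Proof. by apply: ge_inf => //; exists a. Qed.

Lemma En_ge0 f n : 0 <= En f n.
Proof.
apply: lb_le_inf; last by move=> _ [a _ <-]; exact: normL_ge0.
by exists (normL (fun x => f x - trigpol n (fun=> 0) x)), (fun=> 0).
Qed.

(** A near-minimiser stands in for a best approximant, so attainment of the infimum is never at
    issue. *)
Lemma En_adherent f n (e : R) : 0 < e ->
  exists a, normL (fun x => f x - trigpol n a x) < En f n + e.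
Proof.
move=> e0; have [|_ [a _ <-] lt] := inf_adherent e0 (E :=
  [set normL (fun x => f x - trigpol n a x) | a in [set: int -> R[i]]]).
  split=> //.
  by exists (normL (fun x => f x - trigpol n (fun=> 0) x)), (fun=> 0).
by exists a.
Qed.

End BestApproximation.

(** * Assembly of the two implications *)

Theorem theorem6 (R : realType) (f : R -> R[i]) (psi : nat -> R) :
  L2pi f ->
  (forall n, (1 <= n)%N -> 0 < psi n) ->
  (forall n m, (1 <= n <= m)%N -> psi m <= psi n) ->
  (psi n @[n --> \oo] --> (0 : R)) ->
  (exists C : R, forall n, (1 <= n)%N -> psi n <= C * psi (2 * n)%N) ->
  NBVS (fun n : nat => fcoef f n%:Z) ->
  NBVS (fun n : nat => fcoef f (- n%:Z)) ->
  (bigO_nat (fun n => normL (fun x => f x - Sn f n x)) psi <->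
   (bigO_nat (En f) psi /\
    exists C : R, exists N : nat, forall k : int, (N <= `|k|)%N ->
      cmod (fcoef f k) * ln (`|k|%:R) <= C * psi `|k|%N)).
Proof.
move=> [_ fi] p0 pdec _ pdbl Np Nn; have {}fi : cintble f := fi.
split=> [[C [N HC]]|[[CE [NE HE]] [C [N HC]]]].
  split.
    exists C, N => n Nn'; rewrite ger0_norm ?En_ge0 // (le_trans (En_le f n (fcoef f))) //.
    exact: le_trans (ler_norm _) (HC n Nn').
  (* The signs 1 and -1 give the positive and the negative frequencies. *)
  have test (s : int) : `|s|%N = 1%N -> exists C : R, exists N : nat, forall n, (N <= n)%N ->
      cmod (\sum_(1 <= k < n.+1) (k%:R^-1)%:C%C * fcoef f (s * (n + k)%N%:Z)) <= C * psi n.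
    move=> s1; exists (36 * C), N => n Nn'; rewrite (le_trans (fejer_test n fi s1)) //.
    by rewrite -mulrA ler_wpM2l // (le_trans (ler_norm _)) // HC.
  have [C1 [N1 H1]] : exists C : R, exists N : nat, forall n, (N <= n)%N ->
      cmod (fcoef f n%:Z) * ln n%:R <= C * psi n.
    apply: (NBVS_log_bound Np) => //; have [C' [N' H]] := test 1 erefl.
    by exists C', N' => n Nn'; have := H n Nn'; under eq_bigr do rewrite mul1r.
  have [C2 [N2 H2]] : exists C : R, exists N : nat, forall n, (N <= n)%N ->
      cmod (fcoef f (- n%:Z)) * ln n%:R <= C * psi n.
    apply: (NBVS_log_bound Nn) => //; have [C' [N' H]] := test (-1) erefl.
    by exists C', N' => n Nn'; have := H n Nn'; under eq_bigr do rewrite mulN1r.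
  (* One constant must dominate both half-lines; the extra 1 in the threshold forces |k| >= 1, where
     [psi] is positive. *)
  exists (`|C1| + `|C2|), (N1 + N2 + 1)%N => k Nk.
  have pk : 0 < psi `|k|%N by apply: p0; lia.
  have kabs c : cmod (fcoef f k) * ln `|k|%:R <= c * psi `|k|%N -> c <= `|C1| + `|C2| ->
      cmod (fcoef f k) * ln `|k|%:R <= (`|C1| + `|C2|) * psi `|k|%N.
    by move=> h cC; rewrite (le_trans h) // ler_wpM2r // ltW.
  have [k0|k0] := leP 0 k.
    apply: (kabs C1); last by rewrite (le_trans (ler_norm _)) // lerDl.
    by have := H1 `|k|%N ltac:(lia); rewrite gez0_abs.
  apply: (kabs C2); last by rewrite (le_trans (ler_norm _)) // lerDr.
  by have := H2 `|k|%N ltac:(lia); rewrite ltz0_abs // opprK.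
have [C1 [N1 H1]] : exists C : R, exists N : nat, forall n m, (N <= n)%N ->
    (n <= m < 2 * n)%N -> normL (fun x => \sum_(n.+1 <= k < m.+1)
      fcoef f k%:Z * expi (k%:R * (1 * x))) <= C * psi n.
  apply: (normL_frequency_block (normr1 R) Np p0 pdec).
  by exists C, N => n Nn'; apply: (HC n%:Z).
have [C2 [N2 H2]] : exists C : R, exists N : nat, forall n m, (N <= n)%N ->
    (n <= m < 2 * n)%N -> normL (fun x => \sum_(n.+1 <= k < m.+1)
      fcoef f (- k%:Z) * expi (k%:R * (-1 * x))) <= C * psi n.
  apply: (normL_frequency_block (normrN1 R) Nn p0 pdec).
  by exists C, N => n Nn'; have := HC (- n%:Z); rewrite abszN; apply.
(* The slack of the near-minimiser is [psi n] itself, which accounts for CE + 1; the 7 is that of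
   [deviation_le], and C1 + C2 bounds the positive and negative frequency blocks. *)
exists (7 * (CE + 1) + (C1 + C2)), (NE + N1 + N2 + 1)%N => n Nn'.
have pn : 0 < psi n by apply: p0; lia.
have [a Ha] := En_adherent f n pn.
have Hn := HE n ltac:(lia); rewrite ger0_norm ?En_ge0 // in Hn.
rewrite ger0_norm ?normL_ge0 //.
apply: (le_trans (@deviation_le R f n a ((C1 + C2) * psi n) fi ltac:(lia) _)); last by lra.
move=> m nm; have nm' : (n <= m)%N by lia.
rewrite (eq_normL (fun x => SnB_blocks f x nm')).
have ic (c : nat -> R[i]) (s : R) :
    cintble (fun x => \sum_(n.+1 <= k < m.+1) c k * expi (k%:R * (s * x))).
  by apply: cintble_sum => k; apply: cintbleZ; under eq_fun do rewrite mulrA;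
    exact: cintble_expi.
rewrite (le_trans (normLD (ic _ _) (ic _ _))) // mulrDl lerD //.
  by apply: H1 => //; lia.
by apply: H2 => //; lia.
Qed.
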